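(* Consider the noise-free plant and the reference model described in the context, and assume that there exist $K\in\mathbb{R}^{m\times n}$ and $L\in\mathbb{R}^{m\times p}$ such that $$A_{\mathrm m}-A_{\mathrm s}-B_{\mathrm s}K=0,\qquad B_{\mathrm m}-B_{\mathrm s}L=0 .$$ Then the following two statements are equivalent: (i) for any $M\ge0$ and any dataset $(U_M,X_M,X_M^{\mathrm D})$ (as defined in the context) satisfying $\operatorname{im}R_{\mathrm m}\subseteq\operatorname{im}\mathcal{D}(t_M)$, it also holds that $$\operatorname{rank}\begin{bmatrix}X_M\\ U_M\end{bmatrix}=n+m;$$ (ii) $\operatorname{rank}B_{\mathrm m}=m$.
   Context: Noise-free plant ($q=0$): $\dot x(t)=A_{\mathrm s}x(t)+B_{\mathrm s}u(t)$ with $x\in\mathbb{R}^n$, $u\in\mathbb{R}^m$, $A_{\mathrm s}\in\mathbb{R}^{n\times n}$, $B_{\mathrm s}\in\mathbb{R}^{n\times m}$. Reference model: $\dot x_{\mathrm m}(t)=A_{\mathrm m}x_{\mathrm m}(t)+B_{\mathrm m}r(t)$ with $x_{\mathrm m}\in\mathbb{R}^n$, $r\in\mathbb{R}^p$, $m\ge p$, $A_{\mathrm m}\in\mathbb{R}^{n\times n}$ Hurwitz, $B_{\mathrm m}\in\mathbb{R}^{n\times p}$, and $(A_{\mathrm m},B_{\mathrm m})$ controllable. Put $R_{\mathrm m}=\begin{bmatrix}I&0\\ A_{\mathrm m}&B_{\mathrm m}\end{bmatrix}\in\mathbb{R}^{2n\times(n+p)}$. Filters: fix $\rho>0$. For an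 input-state trajectory $(u,x)$ of the plant starting at time $0$, define $\dot x^{\mathrm f}=-\rho x^{\mathrm f}+x$, $\dot u^{\mathrm f}=-\rho u^{\mathrm f}+u$ with $x^{\mathrm f}(0)=0$, $u^{\mathrm f}(0)=0$, and $x^{\mathrm{df}}(t)=x(t)-e^{-\rho t}x(0)-\rho x^{\mathrm f}(t)$. Dataset: from a plant trajectory on an interval $[0,\mathcal{T}]$ and times $0<\tau_1<\dots<\tau_N\le\mathcal{T}$ ($N\ge1$), form $X^{\mathrm D}=[x^{\mathrm{df}}(\tau_1)\cdots x^{\mathrm{df}}(\tau_N)]$, $X=[x^{\mathrm f}(\tau_1)\cdots x^{\mathrm f}(\tau_N)]$, $U=[u^{\mathrm f}(\tau_1)\cdots u^{\mathrm f}(\tau_N)]$ (offline data; initial state, input, $N$ and times are arbitrary). For an integer $M\ge1$, samples at times $0<t_1<\dots<t_M$ of the filtered signals of an online plant trajectory (with its own clock and filters) are appended: $X_M^{\mathrm D}=[X^{\mathrm D}\ x^{\mathrm{df}}(t_1)\cdots x^{\mathrm{df}}(t_M)]$, $X_M=[X\ x^{\mathrm f}(t_1)\cdots x^{\mathrm f}(t_M)]$, $U_M=[U\ u^{\mathrm f}(t_1)\cdots u^{\mathrm f}(t_M)]$. For $M=0$ these are $X^{\mathrm D},X,U$, and $t_0=0$. $\mathcal{D}(t_M)=\frac1{N+M}\begin{bmatrix}X_M\\ X_M^{\mathrm D}\end{bmatrix}\begin{bmatrix}X_M\\ X_M^{\mathrm D}\end{bmatrix}^\top$. *)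

(* Defs.v *)
From mathcomp Require Import all_boot all_order all_algebra.
From mathcomp Require Import complex.
From mathcomp Require Import all_classical all_reals all_analysis.

Set Implicit Arguments.
Unset Strict Implicit.
Unset Printing Implicit Defensive.

Import Order.TTheory GRing.Theory Num.Theory.
Import numFieldNormedType.Exports.

Local Open Scope classical_set_scope.
Local Open Scope ring_scope.

Definition integrable_vec (R : realType) (k : nat) (T : R) (v : R -> 'cV[R]_k)
    : Prop :=
  forall i : 'I_k,
    (@lebesgue_measure R).-integrable `[0, T] (EFin \o (fun s => v s i ord0)).

(* [x' = v] on [0, T] in the sense of Caratheodory: [x] is the integral of an
   integrable [v], i.e. [x] is absolutely continuous and [x' = v] almost
   everywhere.  Inputs are thus allowed to be arbitrary integrable functions
   (continuous, piecewise continuous, bounded measurable, ...); where [v] is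
   continuous this is the classical differential equation. *)
Definition integral_curve (R : realType) (k : nat) (T : R)
    (x v : R -> 'cV[R]_k) : Prop :=
  integrable_vec T v /\
  forall (t : R) (i : 'I_k), 0 <= t <= T ->
    x t i ord0 =
    x 0 i ord0 + \int[@lebesgue_measure R]_(s in `[0, t]) v s i ord0.

Definition trajectory (R : realType) (n m : nat)
    (A : 'M[R]_n) (B : 'M[R]_(n, m)) (T : R)
    (u : R -> 'cV[R]_m) (x : R -> 'cV[R]_n) : Prop :=
  integrable_vec T u /\ integral_curve T x (fun s => A *m x s + B *m u s).

Definition controllable (R : realType) (n m : nat)
    (A : 'M[R]_n) (B : 'M[R]_(n, m)) : Prop :=
  forall x0 x1 : 'cV[R]_n, exists T : R, exists u : R -> 'cV[R]_m,
  exists x : R -> 'cV[R]_n,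
    [/\ 0 < T, trajectory A B T u x, x 0 = x0 & x T = x1].

Definition hurwitz (R : realType) (n : nat) (A : 'M[R]_n) : Prop :=
  forall z : complex R,
    eigenvalue (map_mx (real_complex R) A) z -> complex.Re z < 0.

Definition is_filtered (R : realType) (k : nat) (rho T : R)
    (w wf : R -> 'cV[R]_k) : Prop :=
  wf 0 = 0 /\ integral_curve T wf (fun s => - rho *: wf s + w s).

Definition filtered_derivative (R : realType) (k : nat) (rho : R)
    (x xf : R -> 'cV[R]_k) (t : R) : 'cV[R]_k :=
  x t - expR (- rho * t) *: x 0 - rho *: xf t.

Definition sample (R : realType) (k N : nat) (w : R -> 'cV[R]_k)
    (t : 'I_N -> R) : 'M[R]_(k, N) :=
  \matrix_(i, j) w (t j) i ord0.

(* [(U, X, XD)] collects the filtered signals of one trajectory on some interval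
   [0, T], sampled at times 0 < t_1 < ... < t_N <= T. *)
Definition filtered_samples (R : realType) (n m : nat)
    (A : 'M[R]_n) (B : 'M[R]_(n, m)) (rho : R) (N : nat)
    (U : 'M[R]_(m, N)) (X XD : 'M[R]_(n, N)) : Prop :=
  exists (T : R) (t : 'I_N -> R) (u uf : R -> 'cV[R]_m) (x xf : R -> 'cV[R]_n),
    [/\ 0 <= T,
        trajectory A B T u x,
        is_filtered rho T u uf /\ is_filtered rho T x xf,
        (forall j, 0 < t j <= T) /\
        (forall j j' : 'I_N, (j < j')%N -> t j < t j') &
        [/\ U = sample uf t, X = sample xf t &
            XD = sample (filtered_derivative rho x xf) t]].

(* [N >= 1] samples of an offline trajectory, followed by [M] samples of an
   online one, which has its own clock, horizon and filters. *)
Definition is_dataset (R : realType) (n m : nat)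
    (A : 'M[R]_n) (B : 'M[R]_(n, m)) (rho : R) (N M : nat)
    (UM : 'M[R]_(m, N + M)) (XM XDM : 'M[R]_(n, N + M)) : Prop :=
  exists (U : 'M[R]_(m, N)) (X XD : 'M[R]_(n, N))
         (U' : 'M[R]_(m, M)) (X' XD' : 'M[R]_(n, M)),
    [/\ (1 <= N)%N,
        filtered_samples A B rho U X XD,
        filtered_samples A B rho U' X' XD' &
        [/\ UM = row_mx U U', XM = row_mx X X' & XDM = row_mx XD XD']].

Definition data_gram (R : realType) (n N M : nat)
    (XM XDM : 'M[R]_(n, N + M)) : 'M[R]_(n + n) :=
  (N + M)%N%:R^-1 *: (col_mx XM XDM *m (col_mx XM XDM)^T).

Definition ref_matrix (R : realType) (n p : nat)
    (Am : 'M[R]_n) (Bm : 'M[R]_(n, p)) : 'M[R]_(n + n, n + p) :=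
  block_mx 1%:M 0 Am Bm.

(* [im A] is the column space of [A], whereas [%MS] compares row spaces. *)
Definition im_subset (R : realType) (k a b : nat)
    (A : 'M[R]_(k, a)) (B : 'M[R]_(k, b)) : Prop :=
  (A^T <= B^T)%MS.

(* Main.v *)
Require Import Defs.
From mathcomp Require Import all_boot all_order all_algebra.
From mathcomp Require Import all_classical all_reals all_analysis.
From mathcomp Require Import ring.

(** The filtered data satisfy the plant equation exactly,
    [XD = As X + Bs U] ([filtered_derivativeE], [filtered_samplesE]), so
    [[X; XD]] is the image of [[X; U]] under [[I, 0; As, Bs]].

    If [Bm] has rank [m], the reference matrix has rank [n + m].  Its image lies
    in that of the Gram matrix, whose rank is at most that of [[X; XD]], which is
    at most that of [[X; U]].  Hence [[X; U]], which has [n + m] rows, has full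
    row rank.

    Conversely, replace [L] by some [L'] with [Bs L' = Bm] and the rank of [Bm],
    and drive the plant by [u = K x + L' r].  The closed loop is then the
    reference model with input [r], hence [[X; XD] = Rm [X; V]], where [V]
    samples the filtered [r].  If [[X; V]] has full row rank, then
    [[X; XD]] and its Gram matrix have the same image as [Rm], and the assumed
    implication gives [[X; U]] the rank [n + m].  But [[X; U]] is the image of
    [[X; L' V]] under an invertible matrix, so its rank is at most
    [n + rank Bm].  Therefore [rank Bm >= m], and equality holds since [Bm] has
    [p <= m] columns.

    It remains to excite a controllable pair [(A, B)] by a single trajectory so
    that the filtered state and input samples have full row rank
    ([exciting_trajectory]).  A sum of exponential modes does this: sampling at
    integer times separates the modes as in a Vandermonde system
    ([sample_filtered_mode_free]), and a row [(a, b)] orthogonal to all modes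
    gives [a adj(X - A) B + chi b = 0] as polynomials ([modes_free]).  Comparing
    coefficients of the highest degree gives [b = 0], and [a adj(X - A) B = 0]
    contradicts controllability unless [a = 0] ([controllable_row_adj_eq0]).  The last
    step and the identity for the filtered data both rest on uniqueness for
    linear equations ([integral_curve_linear_eq0]). *)

Import Order.TTheory GRing.Theory Num.Theory.
Import numFieldNormedType.Exports.
Local Open Scope classical_set_scope.
Local Open Scope ring_scope.
Set Implicit Arguments.
Unset Strict Implicit.
Unset Printing Implicit Defensive.

(** * Integral curves *)

Section Analysis.
Variable R : realType.
Local Notation mu := (@lebesgue_measure R).
Implicit Types T : R.

Lemma integrable_Rsum T (I : Type) (r : seq I) (f : I -> R -> R) :
  (forall i, mu.-integrable `[0, T] (EFin \o f i)) ->
  mu.-integrable `[0, T] (EFin \o (fun s => \sum_(i <- r) f i s)).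
Proof.
move=> fi; have -> : EFin \o (fun s => \sum_(i <- r) f i s) =
    (fun s => \sum_(i <- r) (EFin \o f i) s)%E.
  by apply/funext => s /=; rewrite sumEFin.
by apply: integrable_sum.
Qed.

Lemma integrableRZ T a (f : R -> R) :
  mu.-integrable `[0, T] (EFin \o f) ->
  mu.-integrable `[0, T] (EFin \o (fun s => a * f s)).
Proof. by move=> fi; have := @integrableZl _ _ _ _ _ _ a _ fi; apply. Qed.

Lemma integrableRD T (f g : R -> R) :
  mu.-integrable `[0, T] (EFin \o f) -> mu.-integrable `[0, T] (EFin \o g) ->
  mu.-integrable `[0, T] (EFin \o (fun s => f s + g s)).
Proof. by move=> fi gi; have := @integrableD _ _ _ _ _ _ _ _ fi gi; apply. Qed.

Lemma integrable_le T t (f : R -> R) : t <= T ->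
  mu.-integrable `[0, T] (EFin \o f) -> mu.-integrable `[0, t] (EFin \o f).
Proof.
move=> tT; apply: integrableS => //.
by apply: subset_itvl; rewrite bnd_simp.
Qed.

Lemma Rintegral_lincomb T (I : Type) (r : seq I) (a : I -> R) (f : I -> R -> R) :
  (forall i, mu.-integrable `[0, T] (EFin \o f i)) ->
  \int[mu]_(s in `[0, T]) (\sum_(i <- r) a i * f i s) =
  \sum_(i <- r) a i * \int[mu]_(s in `[0, T]) f i s.
Proof.
move=> fi; elim: r => [|i r IH].
  rewrite big_nil; under eq_Rintegral do rewrite big_nil.
  by rewrite Rintegral_cst// mul0r.
rewrite big_cons -IH -RintegralZl// -RintegralD//.
- by apply: eq_Rintegral => s _; rewrite big_cons.
- exact: integrableRZ.
- by apply: integrable_Rsum => j; exact: integrableRZ.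
Qed.

Lemma integral_curve0 k T : integral_curve T (fun=> 0 : 'cV[R]_k) (fun=> 0).
Proof.
split=> [i|t i _].
  have -> : EFin \o (fun s : R => (0 : 'cV[R]_k) i ord0) = cst 0%E.
    by apply/funext => s /=; rewrite mxE.
  exact: integrable0.
under eq_Rintegral do rewrite mxE.
by rewrite Rintegral_cst// mul0r addr0.
Qed.

Lemma integrable_vecD k T (v w : R -> 'cV[R]_k) :
  integrable_vec T v -> integrable_vec T w ->
  integrable_vec T (fun s => v s + w s).
Proof.
move=> vi wi i.
have -> : (fun s => (v s + w s) i ord0) = (fun s => v s i ord0 + w s i ord0).
  by apply/funext => s; rewrite mxE.
exact: integrableRD.
Qed.

Lemma integral_curveD k T (x y v w : R -> 'cV[R]_k) :
  integral_curve T x v -> integral_curve T y w ->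
  integral_curve T (fun s => x s + y s) (fun s => v s + w s).
Proof.
move=> [vi xE] [wi yE]; split=> [|t i tT]; first exact: integrable_vecD.
have /andP[_ tT'] := tT.
rewrite !mxE (xE _ _ tT) (yE _ _ tT).
under [in RHS]eq_Rintegral do rewrite mxE.
rewrite RintegralD//; first by rewrite addrACA.
- exact: integrable_le (vi i).
- exact: integrable_le (wi i).
Qed.

Lemma integrable_vecM k l T (C : 'M[R]_(l, k)) (v : R -> 'cV[R]_k) :
  integrable_vec T v -> integrable_vec T (fun s => C *m v s).
Proof.
move=> vi i.
have -> : (fun s => (C *m v s) i ord0) = (fun s => \sum_j C i j * v s j ord0).
  by apply/funext => s; rewrite mxE.
by apply: integrable_Rsum => j; exact: integrableRZ.
Qed.

Lemma integral_curveM k l T (C : 'M[R]_(l, k)) (x v : R -> 'cV[R]_k) :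
  integral_curve T x v ->
  integral_curve T (fun s => C *m x s) (fun s => C *m v s).
Proof.
move=> [vi xE]; split=> [|t i tT]; first exact: integrable_vecM.
have /andP[_ tT'] := tT.
have vit j : mu.-integrable `[0, t] (EFin \o (fun s => v s j ord0)).
  exact: integrable_le (vi j).
under eq_Rintegral do rewrite mxE.
rewrite (Rintegral_lincomb _ _ vit) !mxE -big_split /=.
by apply: eq_bigr => j _; rewrite (xE _ _ tT) mulrDr.
Qed.

Lemma Rintegral_derive (F f : R -> R) t : 0 <= t ->
  (forall s : R, is_derive s 1 F (f s)) -> continuous f ->
  \int[mu]_(s in `[0, t]) f s = F t - F 0.
Proof.
rewrite le_eqVlt => /predU1P[<-|t0] dF cf.
  by rewrite set_itv1 Rintegral_set1 subrr.
have cF : continuous F.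
  by move=> s; apply/differentiable_continuous/derivable1_diffP; case: (dF s).
rewrite /Rintegral (@continuous_FTC2 _ f F)//.
- exact: continuous_subspaceT.
- split; [by move=> s _; case: (dF s)|exact/cvg_at_right_filter/cF|].
  exact/cvg_at_left_filter/cF.
- by move=> s _; rewrite derive1E; apply: derive_val.
Qed.

Lemma is_derive_expRM (a c s : R) :
  is_derive s 1 (fun t => expR (a * t) * c) (a * (expR (a * s) * c)).
Proof.
have d1 : is_derive s 1 (fun t : R => a * t) a.
  have := @is_deriveZ _ R R id a s 1 1 (is_derive_id _ _).
  by rewrite /GRing.scale /= mulr1.
have d2 := @is_derive1_comp R expR (fun t => a * t) s _ _ (is_derive_expR _) d1.
have := @is_deriveZ _ R R _ c s 1 _ d2.
have -> : c \*: (expR \o (fun t => a * t)) = (fun t => expR (a * t) * c).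
  by apply/funext => t; apply: mulrC.
by rewrite -[_ *: _]/(c * _) [c * _]mulrC [_ * a]mulrC mulrA.
Qed.

Lemma continuous_expRM (a c : R) : continuous (fun t => expR (a * t) * c).
Proof.
move=> s; apply/differentiable_continuous/derivable1_diffP.
by case: (is_derive_expRM a c s).
Qed.

Lemma integrable_expRM T (a c : R) :
  mu.-integrable `[0, T] (EFin \o (fun t => expR (a * t) * c)).
Proof.
apply: continuous_compact_integrable; first exact: segment_compact.
exact/continuous_subspaceT/continuous_expRM.
Qed.

Lemma Rintegral_expRM (a c t : R) : 0 <= t ->
  \int[mu]_(s in `[0, t]) (a * (expR (a * s) * c)) = expR (a * t) * c - c.
Proof.
move=> t0; rewrite (Rintegral_derive t0 (is_derive_expRM a c)).
  by rewrite mulr0 expR0 mul1r.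
under eq_fun do rewrite mulrCA.
exact: continuous_expRM.
Qed.

Lemma integral_curve_expR k T (a c : 'I_k -> R) :
  integral_curve T (fun t => \col_i (expR (a i * t) * c i))
    (fun t => \col_i (a i * (expR (a i * t) * c i))).
Proof.
split=> [i|t i /andP[t0 tT]].
  have -> : (fun s => (\col_i (a i * (expR (a i * s) * c i))) i ord0) =
      (fun s => a i * (expR (a i * s) * c i)).
    by apply/funext => s; rewrite mxE.
  exact/integrableRZ/integrable_expRM.
under eq_Rintegral do rewrite mxE.
by rewrite (Rintegral_expRM _ _ t0) !mxE mulr0 expR0 mul1r addrC subrK.
Qed.

Lemma Rintegral_norm_le T t (f : R -> R) : 0 <= t <= T ->
  mu.-integrable `[0, T] (EFin \o f) ->
  \int[mu]_(s in `[0, t]) `|f s| <= \int[mu]_(s in `[0, T]) `|f s|.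
Proof.
move=> /andP[t0 tT] fi; have nfi := integrable_norm fi.
apply: fine_le.
- by apply: integrable_fin_num => //; exact: integrable_le nfi.
- exact: integrable_fin_num.
- apply: ge0_subset_integral => //.
  + by have /integrableP[] := nfi.
  + by apply: subset_itvl; rewrite bnd_simp.
Qed.

(** Uniqueness for a homogeneous linear equation.  The velocity is only known to
    be integrable, so differential arguments are replaced by a contraction: with
    [c] above the absolute row sums of [C], the weight [exp (2 c t)] is such
    that integrating a bound [D * exp (2 c t)] on the coordinates of [y] through
    the equation returns the same bound with [D / 2]. *)
Lemma integral_curve_linear_eq0 k T (C : 'M[R]_k) (y : R -> 'cV[R]_k) :
  integral_curve T y (fun s => C *m y s) -> y 0 = 0 ->
  forall t, 0 <= t <= T -> y t = 0.
Proof.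
move=> [vi yE] y0.
pose c := 1 + \sum_i \sum_j `|C i j|.
have rowC i : \sum_j `|C i j| <= c.
  rewrite /c [in leRHS](bigD1 i) //= addrCA lerDl addr_ge0// sumr_ge0// => l _.
  by rewrite sumr_ge0.
have c0 : 0 < c.
  by rewrite ltr_wpDr// sumr_ge0// => i _; rewrite sumr_ge0.
have y_le t i : 0 <= t <= T ->
    `|y t i ord0| <= \int[mu]_(s in `[0, t]) `|(C *m y s) i ord0|.
  move=> tT; rewrite (yE _ _ tT) y0 mxE add0r; apply: le_normr_Rintegral => //.
  by have /andP[_ tT'] := tT; exact: integrable_le (vi i).
pose bounded D := forall t i, 0 <= t <= T ->
  `|y t i ord0| <= expR (2 * c * t) * D.
have half D : bounded D -> bounded (D / 2).
  move=> yD t i tT; have /andP[t0 tT'] := tT; apply: le_trans (y_le t i tT) _.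
  have D0 : 0 <= D.
    by have := yD t i tT; move/(le_trans (normr_ge0 _)); rewrite pmulr_rge0// expR_gt0.
  apply: (@le_trans _ _ (expR (2 * c * t) * (D / 2) - D / 2)); last first.
    by rewrite gerBl divr_ge0.
  rewrite -Rintegral_expRM//; apply: le_Rintegral => //.
  - by have := integrable_norm (integrable_le tT' (vi i)).
  - exact/integrableRZ/integrable_expRM.
  move=> s /=; rewrite in_itv/= => /andP[s0 st].
  have sT : 0 <= s <= T by rewrite s0 (le_trans st).
  rewrite mxE; apply: le_trans (ler_norm_sum _ _ _) _.
  have -> : 2 * c * (expR (2 * c * s) * (D / 2)) = c * (expR (2 * c * s) * D).
    by field.
  apply: le_trans (ler_wpM2r _ (rowC i)); last first.
    by rewrite mulr_ge0// expR_ge0.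
  rewrite mulr_suml; apply: ler_sum => j _.
  by rewrite normrM ler_wpM2l// yD.
pose D := \sum_i \int[mu]_(s in `[0, T]) `|(C *m y s) i ord0|.
have yD : bounded D.
  move=> t i tT; have /andP[t0 tT'] := tT; apply: le_trans (y_le t i tT) _.
  apply: le_trans (Rintegral_norm_le tT (vi i)) _.
  have le_D : \int[mu]_(s in `[0, T]) `|(C *m y s) i ord0| <= D.
    rewrite /D (bigD1 i) //= lerDl sumr_ge0// => l _.
    exact: Rintegral_ge0.
  apply: (le_trans le_D); rewrite ler_peMl//.
    by rewrite sumr_ge0// => l _; exact: Rintegral_ge0.
  by rewrite -expR0 ler_expR !mulr_ge0// ltW.
have yDn m : bounded (D / 2 ^+ m).
  elim: m => [|m IH]; first by rewrite expr0 divr1.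
  by rewrite exprSr invfM mulrA; exact: half.
move=> t tT; apply/colP => i; rewrite [RHS]mxE; apply/eqP.
rewrite -normr_eq0; apply/negPn/negP => yn0.
have y_gt0 : 0 < `|y t i ord0| by rewrite lt0r yn0 /=.
pose E := expR (2 * c * t) * D.
have [m mE] : exists m : nat, E / `|y t i ord0| < 2 ^+ m.
  by eexists; exact: upper_nthrootP (leqnn _).
have := yDn m t i tT; rewrite mulrA -/E ler_pdivlMr ?exprn_gt0//.
by apply/negP; rewrite -ltNge -ltr_pdivrMl// mulrC.
Qed.

(** The filtered signals obey the plant equation algebraically: the defect [z]
    between the two sides starts at 0 and satisfies [z' = - rho z], the term
    [exp (- rho t) x(0)] cancelling exactly the unknown initial state. *)
Lemma filtered_derivativeE n m (A : 'M[R]_n) (B : 'M[R]_(n, m)) rho T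
    (u uf : R -> 'cV[R]_m) (x xf : R -> 'cV[R]_n) :
  trajectory A B T u x -> is_filtered rho T u uf -> is_filtered rho T x xf ->
  forall t, 0 <= t <= T ->
  filtered_derivative rho x xf t = A *m xf t + B *m uf t.
Proof.
move=> [ui xc] [uf0 ufc] [xf0 xfc] t tT.
pose e t := \col_i (expR (- rho * t) * x 0 i ord0).
pose z t := x t + (-1)%:M *m e t + (- rho%:M - A) *m xf t + (- B) *m uf t.
have zE s : z s = filtered_derivative rho x xf s - (A *m xf s + B *m uf s).
  have eE : e s = expR (- rho * s) *: x 0 by apply/colP => i; rewrite !mxE.
  rewrite /z /filtered_derivative eE mulmxBl !mulNmx !mul_scalar_mx scaleN1r.
  by rewrite opprD !addrA.
(* [z] is assembled from integral curves so that its velocity can be read off. *)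
have ec := @integral_curve_expR n T (fun=> - rho) (fun i => x 0 i ord0).
have zc : integral_curve T z (fun s => (- rho)%:M *m z s).
  have := integral_curveD (integral_curveD (integral_curveD xc
    (integral_curveM (-1)%:M ec)) (integral_curveM (- rho%:M - A) xfc))
    (integral_curveM (- B) ufc).
  congr integral_curve; apply/funext => s.
  have -> : (\col_i (- rho * (expR (- rho * s) * x 0 i ord0))) = - rho *: e s.
    by apply/colP => i; rewrite !mxE.
  rewrite /z !mul_scalar_mx !mulmxDr !mulmxBl !mulNmx -!scalemxAr !mul_scalar_mx.
  move: (A *m x s) (A *m xf s) (B *m u s) (B *m uf s) (e s) => Ax Axf Bu Buf es.
  by apply/colP => i; rewrite !mxE; ring.
have z0 : z 0 = 0.
  rewrite zE /filtered_derivative xf0 uf0 mulr0 expR0 scale1r subrr scaler0.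
  by rewrite !mulmx0 addr0 !subr0.
apply/eqP; rewrite -subr_eq0 -zE; apply/eqP.
exact: integral_curve_linear_eq0 zc z0 t tT.
Qed.

End Analysis.

(** * Controllability and the adjugate of X - A *)

Section AdjugateCoefficients.
Variables (F : comNzRingType) (n : nat) (A : 'M[F]_n) (a : 'rV[F]_n).

(** The polynomial row [a adj(X - A)] encodes controllability without matrix
    powers: its coefficients span the same space as the rows [a A^k]. *)
Definition row_adj : 'rV[{poly F}]_n := map_mx polyC a *m \adj (char_poly_mx A).

Definition row_adj_coef i : 'rV[F]_n := map_mx (coefp i) row_adj.

Lemma mul_row_adj : row_adj *m char_poly_mx A = char_poly A *: map_mx polyC a.
Proof. by rewrite /row_adj -mulmxA mul_adj_mx mul_mx_scalar. Qed.

(** Reading [a adj(X - A) (X - A) = chi a] coefficientwise gives a recursion on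
    the coefficients of [row_adj]; [row_adj_coef0] and [row_adj_coefS] are its
    initial and general steps. *)
Lemma coef_mul_row_adj i j :
  (row_adj ord0 j * 'X)`_i - (row_adj_coef i *m A) ord0 j = (char_poly A)`_i * a ord0 j.
Proof.
have /rowP/(_ j)/(congr1 (coefp i)) := mul_row_adj.
rewrite /char_poly_mx mulmxBr mul_mx_scalar !mxE /= coefB coefMC => <-.
rewrite mulrC coef_sum; congr (_ - _).
by apply: eq_bigr => l _; rewrite !mxE coefMC.
Qed.

Lemma row_adj_coef0 : row_adj_coef 0 *m A = - (char_poly A)`_0 *: a.
Proof.
apply/rowP => j; rewrite mxE [RHS]mxE mulNr -coef_mul_row_adj coefMX /= sub0r opprK.
by rewrite mxE.
Qed.

Lemma row_adj_coefS i :
  row_adj_coef i.+1 *m A = row_adj_coef i - (char_poly A)`_i.+1 *: a.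
Proof.
apply/rowP => j; rewrite [RHS]mxE [(- _ : 'rV__) _ _]mxE [(_ *: a) _ _]mxE.
by rewrite -coef_mul_row_adj coefMX /= [row_adj_coef i _ _]mxE opprB addrC subrK.
Qed.

(** Beyond the degree of [chi] the recursion is homogeneous, so that vanishing
    propagates downwards from any bound [d] on the sizes of the entries. *)
Lemma row_adj_coef_ge i : (n <= i)%N -> row_adj_coef i = 0.
Proof.
pose d := \max_j size (row_adj ord0 j).
move: {2}(d - i)%N (leqnn (d - i)%N) => k; elim: k i => [|k IH] i dk ni.
  apply/rowP => j; rewrite [LHS]mxE [RHS]mxE /= nth_default//.
  apply: (leq_trans (leq_bigmax (F := fun j => size (row_adj ord0 j)) j)).
  by rewrite -/d -subn_eq0 -leqn0.
have := row_adj_coefS i.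
rewrite IH ?mul0mx; [|by rewrite subnS -subn1 leq_subLR add1n|exact: leqW].
by rewrite nth_default ?size_char_poly// scale0r subr0.
Qed.

End AdjugateCoefficients.

Lemma row_adj_coef_last (F : comNzRingType) n (A : 'M[F]_n.+1) a :
  row_adj_coef A a n = a.
Proof.
have := row_adj_coefS A a n; rewrite row_adj_coef_ge// mul0mx.
have /monicP := char_poly_monic A; rewrite lead_coefE size_char_poly /= => ->.
by rewrite scale1r => /esym/eqP; rewrite subr_eq0 => /eqP.
Qed.

Lemma row_normsq_eq0 (F : realDomainType) n (a : 'rV[F]_n) :
  a *m a^T = 0 -> a = 0.
Proof.
move=> /rowP/(_ ord0); rewrite !mxE => /eqP.
rewrite psumr_eq0 => [/allP aa|j _]; last by rewrite mxE -expr2 sqr_ge0.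
apply/rowP => j; have := aa j (mem_index_enum _).
by rewrite !mxE mulf_eq0 orbb => /eqP.
Qed.

(** The coefficients of [a adj(X - A)] span an [A]-invariant space of rows that
    contains [a].  If they all annihilate [B], then along any trajectory from 0
    their products with the state solve a homogeneous linear equation, hence
    stay 0; steering 0 to [a^T] then forces [a a^T = 0]. *)
Lemma controllable_row_adj_eq0 (R : realType) n m
    (A : 'M[R]_n) (B : 'M[R]_(n, m)) (a : 'rV[R]_n) :
  controllable A B -> row_adj A a *m map_mx polyC B = 0 -> a = 0.
Proof.
case: n A B a => [|n] A B a ctrl aB; first by apply/rowP; case.
pose W := \matrix_(i < n.+1) row_adj_coef A a i.
have aW : (a <= W)%MS.
  have := row_sub (@ord_max n) W; rewrite rowK /=.
  by rewrite row_adj_coef_last.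
have /submxP [C WA] : (W *m A <= W)%MS.
  apply/row_subP => -[i lti]; rewrite row_mul rowK /=.
  case: i lti => [|i] lti; first by rewrite row_adj_coef0 scalemx_sub.
  rewrite row_adj_coefS addmx_sub ?eqmx_opp ?scalemx_sub//.
  by have := row_sub (Ordinal (ltnW lti)) W; rewrite rowK.
have WB : W *m B = 0.
  apply/row_matrixP => i; rewrite row_mul rowK row0.
  apply/rowP => j; have /rowP/(_ j)/(congr1 (coefp i)) := aB.
  rewrite !mxE /= coef0 coef_sum => {2}<-.
  by apply: eq_bigr => l _; rewrite !mxE coefMC.
have [T [u [x [T0 [_ xc] x0 xT]]]] := ctrl 0 a^T.
have Wxc : integral_curve T (fun s => W *m x s) (fun s => C *m (W *m x s)).
  have := integral_curveM W xc; congr integral_curve.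
  by apply/funext => s; rewrite mulmxDr !mulmxA WB mul0mx addr0 WA.
have WxT : W *m a^T = 0.
  have Wx0 : W *m x 0 = 0 by rewrite x0 mulmx0.
  by rewrite -xT (integral_curve_linear_eq0 Wxc Wx0)// lexx ltW.
apply: row_normsq_eq0; have /submxP [D {1}->] := aW.
by rewrite -mulmxA WxT mulmx0.
Qed.

(** * Filtering and sampling *)

Section Filters.
Variables (R : realType) (rho T : R).

Lemma is_filteredM k l (C : 'M[R]_(l, k)) (w wf : R -> 'cV[R]_k) :
  is_filtered rho T w wf ->
  is_filtered rho T (fun s => C *m w s) (fun s => C *m wf s).
Proof.
move=> [wf0 wfc]; split; first by rewrite wf0 mulmx0.
have := integral_curveM C wfc; congr integral_curve.
by apply/funext => s; rewrite mulmxDr -scalemxAr.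
Qed.

Lemma is_filteredD k (v w vf wf : R -> 'cV[R]_k) :
  is_filtered rho T v vf -> is_filtered rho T w wf ->
  is_filtered rho T (fun s => v s + w s) (fun s => vf s + wf s).
Proof.
move=> [vf0 vfc] [wf0 wfc]; split; first by rewrite vf0 wf0 addr0.
have := integral_curveD vfc wfc; congr integral_curve.
by apply/funext => s; rewrite scalerDr addrACA.
Qed.

End Filters.

Lemma sampleM (R : realType) k l N (C : 'M[R]_(l, k)) (w : R -> 'cV[R]_k)
    (t : 'I_N -> R) :
  sample (fun s => C *m w s) t = C *m sample w t.
Proof.
by apply/matrixP => i j; rewrite !mxE; apply: eq_bigr => b _; rewrite mxE.
Qed.

Lemma sampleD (R : realType) k N (v w : R -> 'cV[R]_k) (t : 'I_N -> R) :
  sample (fun s => v s + w s) t = sample v t + sample w t.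
Proof. by apply/matrixP => i j; rewrite !mxE. Qed.

(** * Exponential modes and their samples *)

Section Modes.
Variables (R : realType) (K : nat) (rho : R) (lam : 'I_K -> R).

(** The factor 1 is the initial value in [integral_curve_expR]. *)
Definition mode t : 'cV[R]_K := \col_i (expR (lam i * t) * 1).

Definition filtered_mode t : 'cV[R]_K :=
  \col_i ((expR (lam i * t) - expR (- rho * t)) / (lam i + rho)).

Definition unit_times (j : 'I_K.+1) : R := j.+1%:R.

Lemma mode_curve T :
  integral_curve T mode (fun t => diag_mx (\row_i lam i) *m mode t).
Proof.
have := integral_curve_expR T lam (fun=> 1); congr integral_curve.
by apply/funext => t; apply/colP => i; rewrite mul_diag_mx !mxE.
Qed.

Lemma mode_integrable T : integrable_vec T mode.
Proof.
move=> i; have -> : (fun s => mode s i ord0) = (fun s => expR (lam i * s) * 1).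
  by apply/funext => s; rewrite mxE.
exact: integrable_expRM.
Qed.

Hypothesis lam_rho : forall i, lam i + rho != 0.

Lemma filtered_modeP T : is_filtered rho T mode filtered_mode.
Proof.
split; first by apply/colP => i; rewrite !mxE !mulr0 subrr mul0r.
pose D := diag_mx (\row_i (lam i + rho)^-1).
have := integral_curveD (integral_curveM D (mode_curve T))
  (integral_curveM (- D) (integral_curve_expR T (fun=> - rho) (fun _ : 'I_K => 1))).
congr integral_curve; apply/funext => t; apply/colP => i;
  rewrite mulNmx !mul_diag_mx !mxE; have := lam_rho i.
  by move=> ?; field.
by move=> ?; field.
Qed.

Hypothesis lam_inj : injective lam.

(** At the times 1, ..., K + 1 the samples are combinations of powers of
    [z i = exp (lam i)] and [z0 = exp (- rho)], so that a linear relation between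
    the rows can be tested against any polynomial [q] of degree at most [K].
    Choosing [q] to vanish at [z0] and at all nodes but [z i] isolates the
    coefficient of the mode [i]. *)
Lemma sample_filtered_mode_free : row_free (sample filtered_mode unit_times).
Proof.
pose z i := expR (lam i); pose z0 := expR (- rho).
have zE a j : expR (a * unit_times j) = expR a ^+ j.+1.
  by rewrite /unit_times expRM_natr.
apply: inj_row_free => v v0.
have q_eq0 (q : {poly R}) : (size q <= K.+1)%N ->
    \sum_i v ord0 i / (lam i + rho) * (z i * q.[z i] - z0 * q.[z0]) = 0.
  move=> sq; transitivity
    (\sum_(j < K.+1) q`_j * (v *m sample filtered_mode unit_times) ord0 j).
    under [RHS]eq_bigr do rewrite mxE mulr_sumr.
    rewrite exchange_big; apply: eq_bigr => i _ /=.
    rewrite !(horner_coef_wide _ sq) !mulr_sumr -sumrB mulr_sumr.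
    by apply: eq_bigr => j _; rewrite !mxE !zE !exprS /z /z0; ring.
  by rewrite v0 big1// => j _; rewrite mxE mulr0.
apply/rowP => i; rewrite [RHS]mxE.
(* One node per mode other than [i], and one for the filter: [K] roots. *)
pose s := z0 :: [seq z l | l <- enum (predC1 i)].
pose q := \prod_(y <- s) ('X - y%:P).
have sq : (size q <= K.+1)%N.
  have iK := ltn_ord i.
  by rewrite size_prod_XsubC /= size_map -cardE cardC1 card_ord prednK// (leq_trans _ iK).
have qs y : (q.[y] == 0) = (y \in s) by rewrite -/(root q y) root_prod_XsubC.
have q0 : q.[z0] = 0 by apply/eqP; rewrite qs mem_head.
have := q_eq0 q sq; rewrite (bigD1 i)//= big1 ?addr0 => [|l li].
  rewrite q0 mulr0 subr0 => /eqP.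
  have z_neq0 : (z i == 0) = false by rewrite gt_eqF ?expR_gt0.
  rewrite !mulf_eq0 invr_eq0 (negPf (lam_rho i)) orbF z_neq0 qs /= in_cons.
  case/or3P => [/eqP//|/eqP zi|/mapP [l + zi]].
    by have := lam_rho i; rewrite (expR_inj zi) addNr eqxx.
  by rewrite mem_enum (lam_inj (expR_inj zi)) !inE eqxx.
have -> : q.[z l] = 0.
  by apply/eqP; rewrite qs inE map_f ?orbT// mem_enum.
by rewrite q0 !mulr0 subr0 mulr0.
Qed.

End Modes.

Lemma map_horner_polyC (F : comNzRingType) k l (M : 'M[F]_(k, l)) (c : F) :
  map_mx (horner_eval c) (map_mx polyC M) = M.
Proof. by apply/matrixP => i j; rewrite !mxE /horner_eval hornerC. Qed.

(** * A persistently exciting trajectory *)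

Section ExcitingModes.
Variables (R : realType) (n p K : nat) (A : 'M[R]_n) (B : 'M[R]_(n, p)).
Variables (lam : 'I_K -> R) (dir : 'I_K -> 'I_p).

(** The mode [i] drives the input coordinate [dir i] with [exp (lam i t)].
    Scaling the input by [chi (lam i)] replaces the resolvent by the adjugate,
    which makes sense even when [lam i] is an eigenvalue of [A]. *)
Definition state_modes : 'M[R]_(n, K) := \matrix_(a, i)
  (map_mx (horner_eval (lam i)) (\adj (char_poly_mx A)) *m B) a (dir i).

Definition input_modes : 'M[R]_(p, K) :=
  \matrix_(b, i) ((char_poly A).[lam i] * (b == dir i)%:R).

Lemma modesE : A *m state_modes + B *m input_modes =
  state_modes *m diag_mx (\row_i lam i).
Proof.
apply/matrixP => a i; rewrite mul_mx_diag mxE.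
pose N := map_mx (horner_eval (lam i)) (\adj (char_poly_mx A)).
have NE : ((lam i)%:M - A) *m N = ((char_poly A).[lam i])%:M.
  have := congr1 (map_mx (horner_eval (lam i))) (mul_mx_adj (char_poly_mx A)).
  rewrite map_mxM -/N map_scalar_mx /= /horner_eval => <-; congr (_ *m _).
  apply/matrixP => b c; rewrite !mxE /horner_eval hornerD hornerN hornerC.
  by rewrite hornerMn hornerX.
have AN : A *m (N *m B) = lam i *: (N *m B) - (char_poly A).[lam i] *: B.
  have := congr1 (mulmx^~ B) NE.
  rewrite /= -mulmxA mulmxBl !mul_scalar_mx => <-.
  by rewrite opprB addrC subrK.
have -> : (A *m state_modes) a i = (A *m (N *m B)) a (dir i).
  by rewrite !mxE; apply: eq_bigr => c _; rewrite !mxE.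
have -> : (B *m input_modes) a i = (char_poly A).[lam i] * B a (dir i).
  rewrite mxE (bigD1 (dir i)) //= big1 => [|c /negPf ci]; rewrite !mxE.
    by rewrite eqxx mulr1 addr0 mulrC.
  by rewrite ci !mulr0.
by rewrite AN !mxE subrK mulrC.
Qed.

(** A row [(a, b)] annihilating all modes makes the polynomial
    [a adj(X - A) B e_j + b_j chi], of degree at most [n], vanish at every
    frequency of direction [j]; [n + 1] of them make it zero.  Its coefficient
    of degree [n] is [b_j], and what remains is settled by controllability. *)
Lemma modes_free : controllable A B ->
  (forall j, exists rs : seq 'I_K, [/\ uniq rs, size rs = n.+1 &
     all (fun i => dir i == j) rs]) -> injective lam ->
  row_free (col_mx state_modes input_modes).
Proof.
move=> ctrl modes lam_inj; apply: inj_row_free => v.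
rewrite -[v]hsubmxK mul_row_col; set a := lsubmx v; set b := rsubmx v => ab0.
pose g j : {poly R} := (row_adj A a *m map_mx polyC B) ord0 j + b ord0 j *: char_poly A.
have coefB k j : ((row_adj A a *m map_mx polyC B) ord0 j)`_k =
    (row_adj_coef A a k *m B) ord0 j.
  by rewrite !mxE coef_sum; apply: eq_bigr => l _; rewrite !mxE coefMC.
have g_root i : root (g (dir i)) (lam i).
  have ev : ((row_adj A a *m map_mx polyC B) ord0 (dir i)).[lam i] =
      (a *m (map_mx (horner_eval (lam i)) (\adj (char_poly_mx A)) *m B)) ord0 (dir i).
    transitivity (map_mx (horner_eval (lam i))
      (row_adj A a *m map_mx polyC B) ord0 (dir i)).
      by rewrite [RHS]mxE.
    by rewrite /row_adj !map_mxM /= !map_horner_polyC mulmxA.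
  rewrite /root /g hornerD hornerZ ev.
  have /rowP/(_ i) := ab0; rewrite mxE [RHS]mxE => <-; apply/eqP; congr (_ + _).
    by rewrite !mxE; apply: eq_bigr => k _; rewrite [state_modes _ _]mxE.
  rewrite [RHS]mxE (bigD1 (dir i)) //= big1 => [|k /negPf ki];
    rewrite [input_modes _ _]mxE.
    by rewrite eqxx mulr1 addr0.
  by rewrite ki !mulr0.
have g0 j : g j = 0.
  have [rs [urs srs /allP rsj]] := modes j.
  apply: (@roots_geq_poly_eq0 _ _ (map lam rs)).
  - by apply/allP => _ /mapP [i /rsj /eqP <- ->].
  - by rewrite map_inj_uniq.
  rewrite size_map srs (leq_trans (size_polyD _ _))// geq_max; apply/andP; split.
    apply/leq_sizeP => k nk; rewrite coefB row_adj_coef_ge ?mul0mx ?mxE//.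
    exact: ltnW.
  by rewrite (leq_trans (size_scale_leq _ _))// size_char_poly.
have b0 : b = 0.
  apply/rowP => j; have := congr1 (coefp n) (g0 j).
  rewrite /= coefD coefB row_adj_coef_ge// mul0mx !mxE add0r coefZ coef0.
  have /monicP := char_poly_monic A; rewrite lead_coefE size_char_poly /= => ->.
  by rewrite mulr1.
have a0 : a = 0.
  apply: (controllable_row_adj_eq0 ctrl); apply/rowP => j.
  have bj : b ord0 j = 0 by rewrite b0 mxE.
  by have := g0 j; rewrite /g bj scale0r addr0 => ->; rewrite mxE.
by rewrite a0 b0 row_mx0.
Qed.

End ExcitingModes.

(** One trajectory whose filtered samples have full row rank: its coordinates
    are the exponential modes above, with one frequency for each pair of an input
    direction and an index in 0, ..., n. *)
Lemma exciting_trajectory (R : realType) n p (A : 'M[R]_n) (B : 'M[R]_(n, p)) rho :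
  0 < rho -> controllable A B ->
  exists (N : nat) (T : R) (t : 'I_N -> R)
         (r rf : R -> 'cV[R]_p) (x xf : R -> 'cV[R]_n),
    [/\ (1 <= N)%N, 0 <= T,
        (forall j, 0 < t j <= T) /\
        (forall j j' : 'I_N, (j < j')%N -> t j < t j'),
        [/\ trajectory A B T r x, integrable_vec T x,
            is_filtered rho T r rf & is_filtered rho T x xf] &
        row_free (col_mx (sample xf t) (sample rf t))].
Proof.
move=> rho0 ctrl.
pose I := ('I_n.+1 * 'I_p)%type; pose K := #|{: I}|.
pose lam (i : 'I_K) : R := i.+1%:R.
pose dir (i : 'I_K) : 'I_p := (enum_val i).2.
have lam_inj : injective lam.
  by move=> i j /eqP; rewrite eqr_nat eqSS => /eqP /val_inj.
have lam_rho i : lam i + rho != 0 by rewrite gt_eqF// addr_gt0// ltr0Sn.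
pose X := state_modes A B lam dir; pose V := input_modes A lam dir.
exists K.+1, K.+1%:R, (@unit_times R K), (fun s => V *m mode lam s),
  (fun s => V *m filtered_mode rho lam s), (fun s => X *m mode lam s),
  (fun s => X *m filtered_mode rho lam s).
split=> //.
- split=> [j|j j' jj']; last by rewrite ltr_nat ltnS.
  by rewrite ltr0Sn ler_nat; have := ltn_ord j.
- split; [|exact/integrable_vecM/mode_integrable
    |exact/is_filteredM/filtered_modeP|exact/is_filteredM/filtered_modeP].
  split; first exact/integrable_vecM/mode_integrable.
  have := integral_curveM X (@mode_curve R K lam K.+1%:R); congr integral_curve.
  by apply/funext => s; rewrite !mulmxA -mulmxDl modesE.
rewrite !sampleM -mul_col_mx; apply: inj_row_free => v.
rewrite mulmxA => /eqP; rewrite mulmx_free_eq0; last exact: sample_filtered_mode_free.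
rewrite mulmx_free_eq0; first by move/eqP.
apply: modes_free => // j.
exists [seq enum_rank (k, j) | k <- enum 'I_n.+1]; split.
- rewrite map_inj_uniq ?enum_uniq// => k k' /enum_rank_inj.
  by case.
- by rewrite size_map size_enum_ord.
- by apply/allP => _ /mapP [k _ ->]; rewrite /dir enum_rankK.
Qed.

(** Over an ordered field [Y Y^T k = 0] forces [Y^T k = 0], because the diagonal
    of [(Y^T k)^T (Y^T k)] consists of sums of squares. *)
Lemma submx_gram (F : realFieldType) m n (Y : 'M[F]_(m, n)) :
  (Y^T <= Y *m Y^T)%MS.
Proof.
pose k := cokermx (Y *m Y^T).
have Yk : (Y *m Y^T) *m k = 0 by rewrite mulmx_coker.
rewrite submxE -/k -trmx_eq0.
have kYYk : (Y^T *m k)^T *m (Y^T *m k) = 0.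
  by rewrite trmx_mul trmxK -mulmxA [Y *m _]mulmxA Yk mulmx0.
apply/eqP/row_matrixP => i; rewrite row0; apply: row_normsq_eq0.
have /matrixP/(_ i i) := kYYk.
rewrite [RHS]mxE => kk; apply/matrixP => a b; rewrite !ord1 [RHS]mxE -[RHS]kk !mxE.
by apply: eq_bigr => c _; rewrite !mxE.
Qed.

(** * Datasets and matching *)

Lemma filtered_samplesE (R : realType) n m (A : 'M[R]_n) (B : 'M[R]_(n, m))
    rho N (U : 'M[R]_(m, N)) (X XD : 'M[R]_(n, N)) :
  filtered_samples A B rho U X XD -> XD = A *m X + B *m U.
Proof.
move=> [T [t [u [uf [x [xf [T0 xT [uff xff] [tT _]]]]]]]] [-> -> ->].
rewrite -!sampleM -sampleD; apply/matrixP => i j; rewrite [LHS]mxE [RHS]mxE.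
have /andP[t0 tj] := tT j.
by rewrite (filtered_derivativeE xT uff xff) ?(ltW t0).
Qed.

(** A trajectory at rest on [[0, 0]] serves as the online record when no online
    sample is taken. *)
Lemma zero_filtered_samples (R : realType) n m (A : 'M[R]_n) (B : 'M[R]_(n, m))
    rho :
  @filtered_samples R n m A B rho 0 0 0 0.
Proof.
have zf k : is_filtered rho 0 (fun=> 0 : 'cV[R]_k) (fun=> 0).
  split=> //; have := @integral_curve0 R k 0; congr integral_curve.
  by apply/funext => s; rewrite scaler0 addr0.
exists 0, (fun=> 0), (fun=> 0), (fun=> 0), (fun=> 0), (fun=> 0).
split=> //; [|by split; case|by split; apply/matrixP => i; case].
split; first by case: (@integral_curve0 R m 0).
have := @integral_curve0 R n 0; congr integral_curve.
by apply/funext => s; rewrite !mulmx0 addr0.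
Qed.

Lemma mxrank_ref_matrix (R : realType) n p (A : 'M[R]_n) (B : 'M[R]_(n, p)) :
  \rank (ref_matrix A B) = (n + \rank B)%N.
Proof.
have -> : ref_matrix A B = block_mx 1%:M 0 A 1%:M *m block_mx 1%:M 0 0 B.
  by rewrite mulmx_block !mul1mx !mul0mx !mulmx0 mulmx1 !addr0 add0r.
rewrite eqmxMfull; first by rewrite rank_diag_block_mx mxrank1.
by rewrite row_full_unit unitmxE det_lblock !det1 mulr1 unitr1.
Qed.

Theorem proposition1 (R : realType) (n m p : nat)
  (As : 'M[R]_n) (Bs : 'M[R]_(n, m))
  (Am : 'M[R]_n) (Bm : 'M[R]_(n, p)) (rho : R)
  (le_pm : (p <= m)%N)
  (Am_hurwitz : hurwitz Am)
  (AmBm_controllable : controllable Am Bm)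
  (rho_gt0 : 0 < rho)
  (matching : exists (K : 'M[R]_(m, n)) (L : 'M[R]_(m, p)),
      Am - As - Bs *m K = 0 /\ Bm - Bs *m L = 0) :
  (forall (N M : nat) (UM : 'M[R]_(m, N + M)) (XM XDM : 'M[R]_(n, N + M)),
      is_dataset As Bs rho UM XM XDM ->
      im_subset (ref_matrix Am Bm) (data_gram XM XDM) ->
      \rank (col_mx XM UM) = (n + m)%N)
  <-> \rank Bm = m.
Proof.
split=> [informative|rankBm N M UN XN XDN]; last first.
  move=> [U [X [XD [U' [X' [XD' [_ /filtered_samplesE XDE
    /filtered_samplesE XDE' [-> -> ->]]]]]]]].
  set XM := row_mx X X'; set UM := row_mx U U' => /mxrankS.
  rewrite !mxrank_tr mxrank_ref_matrix rankBm => rankD.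
  apply/eqP; rewrite eqn_leq rank_leq_row (leq_trans rankD)//.
  rewrite (leq_trans (mxrank_scale _ _))// (leq_trans (mxrankM_maxl _ _))//.
  have -> : col_mx XM (row_mx XD XD') = block_mx 1%:M 0 As Bs *m col_mx XM UM.
    rewrite mul_block_col mul1mx mul0mx addr0 XDE XDE'.
    by rewrite !mul_mx_row add_row_mx.
  exact: mxrankM_maxr.
have [K [L [/eqP + /eqP]]] := matching.
rewrite !subr_eq0 => /eqP AmE /eqP BmE.
(* Only [Bs L = Bm] matters, so [L] can be chosen to vanish on the kernel of
   [Bm]; its rank is then at most that of [Bm]. *)
have [L' [BL rankL]] : exists L' : 'M[R]_(m, p),
    Bs *m L' = Bm /\ (\rank L' <= \rank Bm)%N.
  exists (L *m pinvmx Bm *m Bm); split; last exact: mxrankM_maxr.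
  by rewrite -mulmxA mulmxA -BmE mulmxA mulmxKpV.
have [N [T [t [r [rf [x [xf [N1 T0 tT [[ri xc] xi rff xff] Zfree]]]]]]]] :=
  exciting_trajectory rho_gt0 AmBm_controllable.
pose X := sample xf t; pose V := sample rf t; pose U := K *m X + L' *m V.
pose XD := As *m X + Bs *m U.
(* The feedback [u = K x + L' r] turns the exciting trajectory of the reference
   model into a trajectory of the plant with the same state. *)
have samples : filtered_samples As Bs rho U X XD.
  pose u s := K *m x s + L' *m r s; pose uf s := K *m xf s + L' *m rf s.
  have uff : is_filtered rho T u uf.
    by apply: is_filteredD; exact: is_filteredM.
  have ui : integrable_vec T u.
    by apply: integrable_vecD; apply: integrable_vecM.
  have xT : trajectory As Bs T u x.
    split=> //; move: xc; congr integral_curve; apply/funext => s.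
    rewrite /u mulmxDr !mulmxA BL addrA -mulmxDl; congr (_ *m _ + _).
    by rewrite -AmE addrC subrK.
  have UE : U = sample uf t by rewrite /uf sampleD !sampleM.
  exists T, t, u, uf, x, xf; split=> //; split=> //.
  rewrite /XD UE -!sampleM -sampleD; apply/matrixP => i j.
  rewrite [LHS]mxE [RHS]mxE (filtered_derivativeE xT uff xff)//.
  by have /andP[/ltW t0 ->] := tT.1 j; rewrite t0.
have XDE : XD = Am *m X + Bm *m V.
  rewrite /XD /U mulmxDr !mulmxA BL addrA -mulmxDl; congr (_ *m _ + _).
  by rewrite -AmE addrC subrK.
pose XN : 'M[R]_(n, N + 0) := row_mx X 0.
pose UN : 'M[R]_(m, N + 0) := row_mx U 0.
pose XDN : 'M[R]_(n, N + 0) := row_mx XD 0.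
have data : is_dataset (N := N) (M := 0) As Bs rho
    UN XN XDN.
  exists U, X, XD, 0, 0, 0; split=> //.
  exact: zero_filtered_samples.
have Rm_sub : im_subset (ref_matrix Am Bm) (data_gram XN XDN).
  have N0 : (N + 0)%:R != 0 :> R by rewrite pnatr_eq0 addn0 -lt0n.
  rewrite /im_subset /data_gram linearZ /= trmx_mul trmxK.
  rewrite (eqmx_scale _ (invr_neq0 N0)).
  apply: submx_trans (submx_gram _).
  have [Y ZY] := row_freeP Zfree.
  pose W : 'M[R]_(n + p, N + 0) := col_mx X V *m row_mx 1%:M 0.
  (* As [W] has a right inverse, the image of [Rm *m W] is all of that of [Rm]. *)
  have WY : W *m (col_mx 1%:M 0 *m Y) = 1%:M.
    by rewrite mulmxA -(mulmxA (col_mx X V)) mul_row_col mulmx1 mul0mx addr0 mulmx1.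
  have -> : col_mx XN XDN = ref_matrix Am Bm *m W.
    rewrite /W mulmxA mul_block_col mul1mx mul0mx addr0 -XDE.
    by rewrite mul_col_mx !mul_mx_row !mulmx1 !mulmx0.
  by rewrite -{1}[ref_matrix _ _]mulmx1 -WY mulmxA [X in (X <= _)%MS]trmx_mul submxMl.
have := informative N 0 _ _ _ data Rm_sub.
have -> : col_mx XN UN = block_mx 1%:M 0 K 1%:M *m
    col_mx XN (L' *m row_mx V 0) :> 'M[R]_(n + m, N + 0).
  rewrite mul_block_col !mul1mx mul0mx addr0.
  by rewrite !mul_mx_row !mulmx0 add_row_mx addr0.
move=> rk; apply/eqP; rewrite eqn_leq (leq_trans (rank_leq_col _) le_pm) /=.
rewrite -(leq_add2l n) -rk (leq_trans (mxrankM_maxr _ _))//.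
rewrite -addsmxE (leq_trans (mxrank_adds_leqif _ _))// leq_add ?rank_leq_row//.
exact: leq_trans (mxrankM_maxl _ _) rankL.
Qed.
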